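(* Let $S$ be an integral domain that is not a field, let $F$ be its field of fractions, let $A \neq F$ be an $F$-algebra, and let $\mathbb{S}$ be the set of all $S$-nice subalgebras of $A$, assumed nonempty and endowed with the topology described in the context. Let $I$ be an irreducible subset of $\mathbb{S}$. Then $\bigcup_{R \in I} R$ is an $S$-nice subalgebra of $A$; in particular, the supremum of $I$ in $\mathbb{S}$ (with respect to inclusion) exists and $\sup I = \bigcup_{R \in I} R$.
   Context: Algebras are associative and unital, not necessarily commutative, and $F$ is identified with its image in $A$. An $S$-subalgebra $R$ of $A$ is called $S$-nice if $R \cap F = S$ and $FR = A$ (where $FR$ is the set of finite sums $\sum t_i r_i$, $t_i \in F$, $r_i \in R$). For $M \subseteq A$ let $V(M)$ be the set of all $S$-nice subalgebras of $A$ containing $M$. The sets $V(M)$, $M \subseteq A$, form a basis of the topology on $\mathbb{S}$; equivalently, a subset of $\mathbb{S}$ is open iff it is an upper set with respect to inclusion, and closed iff it is a lower set with respect to inclusion. The specialization order ($R_1 \le R_2$ iff $R_1$ lies in the closure of $\{R_2\}$) is inclusion. A subset $I$ of a topological space is irreducible if it is nonempty and whenever $I \subseteq G_1 \cup G_2$ with $G_1, G_2$ closed, then $I \subseteq G_1$ or $I \subseteq G_2$. *)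

(* Defs.v *)
From HB Require Import structures.
From mathcomp Require Import all_boot all_order all_algebra.
From mathcomp Require Import all_classical topology.

Set Implicit Arguments.
Unset Strict Implicit.
Unset Printing Implicit Defensive.

Import Order.TTheory GRing.Theory.

Local Open Scope classical_set_scope.
Local Open Scope ring_scope.

Section NiceSubalgebras.
Variables (S : idomainType) (A : algType {fraction S}).
Implicit Types (R M : set A).

(* S acts on A through S -> {fraction S}. *)
Definition is_Ssubalgebra R :=
  subring_closed (mem R) /\
  forall (s : S) (r : A), R r -> R (FracField.tofrac s *: r).

(* The image of F = {fraction S} in A. *)
Definition imF : set A := range (in_alg A).

(* The image of S in A. *)
Definition imS : set A := range (fun s : S => in_alg A (FracField.tofrac s)).

(* FR: the finite sums of the t_i r_i with t_i in F and r_i in R. *)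
Definition Fspan R : set A :=
  [set a | exists n (t : 'I_n -> {fraction S}) (r : 'I_n -> A),
    (forall i, R (r i)) /\ a = \sum_(i < n) t i *: r i].

Definition is_Snice R :=
  [/\ is_Ssubalgebra R, R `&` imF = imS & Fspan R = setT].

Record niceAlg := NiceAlg {
  carrier :> set A;
  carrierP : `[< is_Snice carrier >]
}.

HB.instance Definition _ := [isSub for carrier].
HB.instance Definition _ := [Choice of niceAlg by <:].

(* The order induced by the inclusion order on set A. *)
HB.instance Definition _ :=
  [SubChoice_isSubPOrder of niceAlg by <: with set_display].

Definition niceV M : set niceAlg := [set R | M `<=` carrier R].

Fact niceV_cover : \bigcup_(M in setT) niceV M = setT.
Proof. by rewrite -subTset => R _; exists set0 => // x []. Qed.

Fact niceV_join M N (R : niceAlg) : setT M -> setT N -> niceV M R ->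
  niceV N R -> exists K, [/\ setT K, niceV K R & niceV K `<=` niceV M `&` niceV N].
Proof.
move=> _ _ MR NR; exists (M `|` N); split=> //; first by move=> x [/MR|/NR].
by move=> Q MNQ; split=> x Hx; apply: MNQ; [left|right].
Qed.

HB.instance Definition _ := @isBaseTopological.Build niceAlg
  (set A) setT niceV niceV_cover niceV_join.

End NiceSubalgebras.

Arguments imF {S} A.
Arguments imS {S} A.

Definition irreducible_set (T : topologicalType) (I : set T) :=
  I !=set0 /\
  forall G1 G2 : set T, closed G1 -> closed G2 -> I `<=` G1 `|` G2 ->
    I `<=` G1 \/ I `<=` G2.

Section Facts.
Variables (S : idomainType) (A : algType {fraction S}).
Implicit Types (R Q : niceAlg A) (U : set (niceAlg A)).

Lemma niceAlg_leP R Q : (R <= Q)%O <-> carrier R `<=` carrier Q.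
Proof. by rewrite -Order.le_val; split=> /asboolP. Qed.

Lemma open_niceAlgP U :
  open U <-> (forall R Q, U R -> (R <= Q)%O -> U Q).
Proof.
split=> [[D _ <-] R Q [M DM MR] /niceAlg_leP RQ|up].
  by exists M => //; apply: subset_trans RQ.
exists [set M | exists2 R, U R & M = carrier R] => //.
apply/seteqP; split=> [Q [_ [R UR ->] RQ]|R UR].
  by apply: (up R) => //; apply/niceAlg_leP.
by exists (carrier R) => //; exists R.
Qed.

End Facts.

(* Main.v *)
Require Import Defs.
From HB Require Import structures.
From mathcomp Require Import all_boot all_order all_algebra.
From mathcomp Require Import all_classical topology.

Set Implicit Arguments.
Unset Strict Implicit.
Unset Printing Implicit Defensive.

Import Order.TTheory GRing.Theory.

Local Open Scope classical_set_scope.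
Local Open Scope ring_scope.

(** Closed sets are the lower sets for inclusion, so irreducibility says that
    a set covered by two lower sets lies in one of them.  This forces directedness
    ([irreducible_directed]): any two members of an irreducible set are contained
    in a third one.

    A nonempty directed union of nice algebras is nice
    ([is_Snice_directed_bigcup]): the ring operations take at most two elements,
    which lie in a common member, and the conditions [R `&` F = S] and [F R = A]
    pass to unions, the former because intersection distributes over union, the
    latter because it is inherited by every larger set.  Once the union is a
    nice algebra, it is the supremum because it is already the supremum among
    all subsets of [A]. *)

Section DirectedUnions.
Variables (S : idomainType) (A : algType {fraction S}).
Implicit Types (R Q : niceAlg A) (I : set (niceAlg A)) (M N : set A).

Lemma closed_niceAlg_not_ge R : closed [set Q | ~ (R <= Q)%O].
Proof.
rewrite -openC; apply/open_niceAlgP => Q Q' /contrapT RQ QQ' /=; apply.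
exact: le_trans QQ'.
Qed.

(** Without a common upper bound in [I], every member of [I] fails to contain
    [R1] or [R2], so [I] is covered by two closed sets, the first missing [R1]
    and the second missing [R2]. *)
Lemma irreducible_directed I R1 R2 : irreducible_set I -> I R1 -> I R2 ->
  exists Q, [/\ I Q, (R1 <= Q)%O & (R2 <= Q)%O].
Proof.
move=> [_ irrI] IR1 IR2; apply: contrapT => noQ.
have cov : I `<=` [set Q | ~ (R1 <= Q)%O] `|` [set Q | ~ (R2 <= Q)%O].
  move=> Q IQ; case: (pselect (R1 <= Q)%O) => [R1Q|]; last by left.
  by right => R2Q; apply: noQ; exists Q.
have [/(_ _ IR1)|/(_ _ IR2)] := irrI _ _ (@closed_niceAlg_not_ge R1)
  (@closed_niceAlg_not_ge R2) cov; exact.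
Qed.

Lemma is_Snice_carrier R : is_Snice (carrier R).
Proof. exact/asboolP/carrierP. Qed.

Lemma sub_Fspan M N : M `<=` N -> Fspan M `<=` Fspan N.
Proof.
by move=> MN a [n [t [r [Mr ->]]]]; exists n, t, r; split=> // i; apply: MN.
Qed.

(** Directedness serves the ring operations, which take two arguments;
    scaling by [S] and the other two conditions involve one member at a time. *)
Lemma is_Snice_directed_bigcup I : I !=set0 ->
  (forall R1 R2, I R1 -> I R2 ->
     exists Q, [/\ I Q, (R1 <= Q)%O & (R2 <= Q)%O]) ->
  is_Snice (\bigcup_(R in I) carrier R).
Proof.
move=> [R0 IR0] dirI; set U := \bigcup_(R in I) _.
(* The ring operations are computed in a member containing both arguments. *)
have common x y : U x -> U y ->
    exists Q, [/\ I Q, x \in mem (carrier Q) & y \in mem (carrier Q)].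
  move=> [R1 IR1 R1x] [R2 IR2 R2y].
  have [Q [IQ /niceAlg_leP R1Q /niceAlg_leP R2Q]] := dirI _ _ IR1 IR2.
  by exists Q; split=> //; rewrite inE; [exact: R1Q|exact: R2Q].
split.
- split; first split.
  + have [[[R0_1 _ _] _] _ _] := is_Snice_carrier R0.
    by rewrite inE; exists R0 => //; move: R0_1; rewrite inE.
  + move=> x y; rewrite !inE => Ux Uy; have [Q [IQ Qx Qy]] := common _ _ Ux Uy.
    have [[[_ QB _] _] _ _] := is_Snice_carrier Q.
    by exists Q => //; have := QB _ _ Qx Qy; rewrite inE.
  + move=> x y; rewrite !inE => Ux Uy; have [Q [IQ Qx Qy]] := common _ _ Ux Uy.
    have [[[_ _ QM] _] _ _] := is_Snice_carrier Q.
    by exists Q => //; have := QM _ _ Qx Qy; rewrite inE.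
  + move=> s x [R IR Rx]; have [[_ RZ] _ _] := is_Snice_carrier R.
    by exists R => //; apply: RZ.
- rewrite setI_bigcupl; apply/seteqP; split=> [x [R IR]|x Sx].
    by have [_ -> _] := is_Snice_carrier R.
  by exists R0 => //; have [_ -> _] := is_Snice_carrier R0.
- rewrite -subTset; have [_ _ <-] := is_Snice_carrier R0.
  exact/sub_Fspan/bigcup_sup.
Qed.

End DirectedUnions.

Theorem theorem2p10 (S : idomainType) (A : algType {fraction S})
  (S_not_field : ~ (forall x : S, x != 0 -> x \is a GRing.unit))
  (A_neq_F : imF A <> [set: A])
  (nice_nonempty : [set: niceAlg A] !=set0)
  (I : set (niceAlg A)) (I_irr : irreducible_set I) :
  is_Snice (\bigcup_(R in I) carrier R) /\
  exists U : niceAlg A, carrier U = \bigcup_(R in I) carrier R /\ isLub I U.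
Proof.
have niceU : is_Snice (\bigcup_(R in I) carrier R).
  apply: is_Snice_directed_bigcup; first by case: I_irr.
  by move=> R1 R2; apply: irreducible_directed.
split=> //; exists (NiceAlg (introT (asboolP _) niceU)); split=> //.
split=> [R IR|Q ubQ]; apply/niceAlg_leP => /=; first exact: bigcup_sup.
by apply: bigcup_sub => R IR; apply/niceAlg_leP/ubQ.
Qed.
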